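(* If the provers are honest and their individual operations satisfy $\bar{\mu} \geq h_k^{-1}(t) + \epsilon$, then the winning rate $R$ in the teleportation-based ping-pong test is bounded by $R \geq t$ with probability at least $1 - e^{-n\epsilon^2}$, where $t\in(\tfrac{5}{6},1]$ is a winning threshold and $h_k(\bar{\mu}) = \frac{\bar{\mu}(\bar{\mu}^k-1)}{k(\bar{\mu}-1)}$.
   Context: In the teleportation-based ping-pong test of maximum depth $k$, each of $n$ IID executions picks a depth $\kappa\in\{1,\dots,k\}$ uniformly, single-qubit Clifford gates $C_1,\dots,C_\kappa$ uniformly and a Pauli eigenstate $|\psi\rangle$ uniformly; the state is teleported back and forth between nodes $A$ and $B$ $\kappa$ times, at round $j$ undergoing the teleportation-and-memory channel $M^{\mathcal{T}}_j$ followed by $C_j$, and is finally measured with projector $\bigcirc_{j=1}^{\kappa}C_j(|\psi\rangle\langle\psi|)$, giving a bit $v^i\in\{0,1\}$ (1 = accept). The winning rate is $R=\frac{1}{n}\sum_i v^i$. The quality of memory and gates is assumed the same in every round, given by the average fidelity $\bar{\mu}=\int d\psi\,\mathrm{Tr}[C_j\circ M^{\mathcal{T}}_j(|\psi\rangle\langle\psi|)\cdot C_j(|\psi\rangle\langle\psi|)]$ for all $j$ (Haar measure $d\psi$). The accuracy $\epsilon$ is as in the Hoeffding bound $\Pr[|R-P_{\checkmark}|\le\epsilon]\ge 1-2e^{-2n\epsilon^2}$, with $P_{\checkmark}$ the average success probability. *)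

(* Defs.v *)
From HB Require Import structures.
From mathcomp Require Import all_boot all_algebra complex.
From mathcomp Require Import all_classical all_reals all_analysis.

Set Implicit Arguments.
Unset Strict Implicit.
Unset Printing Implicit Defensive.

Import GRing.Theory Num.Theory.
Local Open Scope ring_scope.

Section QubitDefs.
Variable R : realType.

Local Notation qmx := 'M[R[i]]_2.

Definition cR (x : R) : R[i] := Complex x 0.
Definition cI : R[i] := Complex 0 1.

Definition adj (A : qmx) : qmx := (map_mx Num.conj A)^T.

(* Pauli matrices: a = 0 -> X, a = 1 -> Y, a = 2 -> Z *)
Definition pauli (a : 'I_3) : qmx :=
  \matrix_(r < 2, c < 2)
    match nat_of_ord a with
    | 0%N => if r == c then 0 else 1
    | 1%N => if r == c then 0 else if nat_of_ord r == 0%N then - cI else cI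
    | _ => if r == c then (if nat_of_ord r == 0%N then 1 else -1) else 0
    end.

Definition is_unitary (U : qmx) : Prop := adj U *m U = 1%:M.

Definition is_clifford (U : qmx) : Prop :=
  is_unitary U /\
  forall a : 'I_3, exists b : 'I_3, exists s : bool,
      U *m pauli a *m adj U = (if s then -1 else 1) *: pauli b.

Definition uconj (U : qmx) (rho : qmx) : qmx := U *m rho *m adj U.

Definition clifford_enum (N : nat) (cl : 'I_N -> qmx) : Prop :=
  [/\ forall i, is_clifford (cl i),
      forall U, is_clifford U -> exists i, forall rho, uconj U rho = uconj (cl i) rho
    & forall i j, (forall rho, uconj (cl i) rho = uconj (cl j) rho) -> i = j].

Definition is_channel (K : seq qmx) : Prop := \sum_(A <- K) adj A *m A = 1%:M.
Definition kraus (K : seq qmx) (rho : qmx) : qmx := \sum_(A <- K) A *m rho *m adj A.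

Definition pauli_eig (p : bool * 'I_3) : qmx :=
  cR 2^-1 *: (1%:M + (if p.1 then 1 else -1) *: pauli p.2).

(* pure state with Bloch angles (theta, phi):
   |psi> = cos(theta/2)|0> + e^{i phi} sin(theta/2)|1> *)
Definition bloch_state (th ph : R) : qmx :=
  cR 2^-1 *: (1%:M + cR (sin th * cos ph) *: pauli 0
                   + cR (sin th * sin ph) *: pauli 1
                   + cR (cos th) *: pauli 2).

(* Haar (unitarily invariant) average of f over pure qubit states,
   i.e. the normalized uniform measure on the Bloch sphere *)
Definition haar_avg (f : qmx -> R) : R :=
  (4 * pi)^-1 *
  Rintegral (@lebesgue_measure R) `[0, pi]%classic
    (fun th => Rintegral (@lebesgue_measure R) `[0, 2 * pi]%classic
                 (fun ph => f (bloch_state th ph)) * sin th).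

Definition avg_fid (Phi Target : qmx -> qmx) : R :=
  haar_avg (fun rho => complex.Re (\tr (Phi rho *m Target rho))).

Fixpoint noisy_run (N : nat) (M : nat -> seq qmx) (cl : 'I_N -> qmx)
    (cs : seq 'I_N) (j : nat) (rho : qmx) : qmx :=
  match cs with
  | [::] => rho
  | c :: cs' => noisy_run M cl cs' j.+1 (uconj (cl c) (kraus (M j) rho))
  end.

Fixpoint ideal_run (N : nat) (cl : 'I_N -> qmx) (cs : seq 'I_N) (rho : qmx) : qmx :=
  match cs with
  | [::] => rho
  | c :: cs' => ideal_run cl cs' (uconj (cl c) rho)
  end.

(* average success probability P_check of one execution of the ping-pong
   test of maximum depth k: kappa uniform in {1..k}, Cliffords uniform,
   Pauli eigenstate uniform; rounds numbered 0..kappa-1 use M 0 .. M (kappa-1) *)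
Definition success_prob (N : nat) (cl : 'I_N -> qmx) (M : nat -> seq qmx) (k : nat) : R :=
  k%:R^-1 * \sum_(kap < k)
    (N%:R ^+ kap.+1)^-1 * \sum_(cs : (kap.+1).-tuple 'I_N)
      6^-1 * \sum_(p : bool * 'I_3)
        complex.Re (\tr (noisy_run M cl cs 0 (pauli_eig p) *m ideal_run cl cs (pauli_eig p))).

Definition win_rate (n : nat) (v : {ffun 'I_n -> bool}) : R :=
  n%:R^-1 * \sum_(i < n) (v i)%:R.

Definition prob_rate_ge (n : nat) (P t : R) : R :=
  \sum_(v : {ffun 'I_n -> bool} | t <= win_rate v)
     \prod_(i < n) (if v i then P else 1 - P).

(* h_k(mu) = mu (mu^k - 1) / (k (mu - 1)), extended continuously by 1 at mu = 1 *)
Definition hk (k : nat) (mu : R) : R :=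
  if mu == 1 then 1 else mu * (mu ^+ k - 1) / (k%:R * (mu - 1)).

End QubitDefs.

(* Main.v *)
(** A bilinear form on qubit operators that is invariant under conjugation by
    Clifford gates is a combination of [tr X * tr Y] and [tr (X Y)].  So
    averaging over the gates turns each round into the depolarizing map of the
    same average fidelity [mu], and the Pauli eigenstates, a spherical 2-design,
    average the fidelity exactly as Haar-random states do.  Hence a run of depth
    [m] succeeds with probability [(1 + (2 mu - 1) ^ m) / 2], which is at least
    [mu ^ m] by convexity, and the success probability [P] of the test is at
    least [hk k mu].  As [(mu0 + eps) ^ m >= (1 + eps) mu0 ^ m] for [m >= 1], it
    follows that [P >= (1 + eps) t >= t + 5 eps / 6], so that Hoeffding's bound
    [exp (- 2 n (P - t) ^ 2)] on the tail is below [exp (- n eps ^ 2)]. *)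

Require Import Defs.
From HB Require Import structures.
From mathcomp Require Import all_boot all_algebra complex.
From mathcomp Require Import all_classical all_reals all_analysis.
From mathcomp Require Import all_order ring lra.

Set Implicit Arguments.
Unset Strict Implicit.
Unset Printing Implicit Defensive.

Import Order.TTheory GRing.Theory Num.Theory.
Local Open Scope ring_scope.

(** * Hoeffding's inequality for the winning rate *)

Lemma is_derive1_ge0_ndecry {R : realType} (f F : R -> R) (a b : R) :
  (forall x, is_derive x (1 : R) F (f x)) -> (forall x, a <= x -> 0 <= f x) ->
  a <= b -> F a <= F b.
Proof.
move=> dF f0 ab; apply: (@ger0_derive1_ndecry _ F a) => // [x|].
  rewrite in_itv/= andbT => /ltW ax.
  by rewrite derive1E (@derive_val _ _ _ _ _ _ _ (dF x)) f0.
by apply: derivable_within_continuous => x _; case: (dF x).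
Qed.

Lemma sum_prod_ffun_bool (S : comPzSemiRingType) n (w : bool -> S) :
  \sum_(v : {ffun 'I_n -> bool}) \prod_(i < n) w (v i)
  = (w true + w false) ^+ n.
Proof.
by rewrite -(bigA_distr_bigA (fun=> w)) prodr_const card_ord big_bool.
Qed.

Section Hoeffding.
Context {R : realType}.
Implicit Types (P s t x : R) (n : nat).

Definition bernoulli_mgf P s : R := P * expR s + (1 - P).

Lemma bernoulli_mgf_gt0 P s : 0 <= P <= 1 -> 0 < bernoulli_mgf P s.
Proof.
move=> /andP[P0 P1]; have [->|Pn1] := eqVneq P 1.
  by rewrite /bernoulli_mgf mul1r subrr addr0 expR_gt0.
by rewrite ltr_wpDl ?mulr_ge0 ?expR_ge0// subr_gt0 lt_neqAle Pn1.
Qed.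

Lemma bernoulli_mgf0 P : bernoulli_mgf P 0 = 1.
Proof. by rewrite /bernoulli_mgf expR0 mulr1 addrC subrK. Qed.

(* The success probability of the exponentially tilted Bernoulli law, that is,
   the derivative of the logarithm of its moment generating function. *)
Definition bernoulli_tilt P s : R := P * expR s / bernoulli_mgf P s.

#[local] Instance is_derive_bernoulli_mgf P s :
  is_derive s (1 : R) (bernoulli_mgf P) (P * expR s).
Proof. by apply: is_derive_eq; rewrite /GRing.scale /=; ring. Qed.

Lemma is_derive_bernoulli_tilt P s : 0 <= P <= 1 ->
  is_derive s (1 : R) (bernoulli_tilt P)
    (bernoulli_tilt P s * (1 - bernoulli_tilt P s)).
Proof.
move=> /(bernoulli_mgf_gt0 s)/lt0r_neq0 mgf_neq0; rewrite /bernoulli_tilt.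
apply: is_derive_eq; rewrite /GRing.scale /=.
by field.
Qed.

Lemma bernoulli_tilt_le P s : 0 <= P <= 1 -> 0 <= s ->
  bernoulli_tilt P s <= P + s / 4.
Proof.
move=> P01 s0; pose slack x := P + x / 4 - bernoulli_tilt P x.
have dslack x : is_derive x (1 : R) slack ((2^-1 - bernoulli_tilt P x) ^+ 2).
  have dtilt := is_derive_bernoulli_tilt x P01.
  by apply: is_derive_eq; rewrite /GRing.scale /=; field.
have := is_derive1_ge0_ndecry dslack (fun x _ => sqr_ge0 _) s0.
rewrite /slack /bernoulli_tilt bernoulli_mgf0 expR0 mul0r mulr1 divr1 addr0.
by rewrite subrr subr_ge0.
Qed.

Lemma bernoulli_mgf_le_ge0 P s : 0 <= P <= 1 -> 0 <= s ->
  bernoulli_mgf P s <= expR (s * P + s ^+ 2 / 8).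
Proof.
move=> P01 s0; pose bound x := x * P + x ^+ 2 / 8.
pose F x := - (bernoulli_mgf P x * expR (- bound x)).
pose dF x :=
  expR (- bound x) * bernoulli_mgf P x * (P + x / 4 - bernoulli_tilt P x).
have FE x : is_derive x (1 : R) F (dF x).
  have mgf_neq0 := lt0r_neq0 (bernoulli_mgf_gt0 x P01).
  apply: is_derive_eq; rewrite /GRing.scale /= /dF /bernoulli_tilt.
  by field.
have dF0 x : 0 <= x -> 0 <= dF x.
  move=> x0; rewrite !mulr_ge0 ?expR_ge0 ?(ltW (bernoulli_mgf_gt0 _ _))//.
  by rewrite subr_ge0 bernoulli_tilt_le.
have := is_derive1_ge0_ndecry FE dF0 s0.
rewrite /F lerN2 expRN ler_pdivrMr ?expR_gt0//.
rewrite /bound bernoulli_mgf0 mul0r expr0n mul0r addr0 oppr0 expR0 mulr1.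
by rewrite mul1r.
Qed.

(* Negating [s] exchanges the two outcomes. *)
Lemma bernoulli_mgf_le P s : 0 <= P <= 1 ->
  bernoulli_mgf P s <= expR (s * P + s ^+ 2 / 8).
Proof.
move=> P01; have [/bernoulli_mgf_le_ge0 -> //|s0] := leP 0 s.
have -> : bernoulli_mgf P s = expR s * bernoulli_mgf (1 - P) (- s).
  by rewrite /bernoulli_mgf mulrDr mulrCA -expRD subrr expR0; ring.
have -> : s * P + s ^+ 2 / 8 = s + (- s * (1 - P) + (- s) ^+ 2 / 8) by field.
rewrite expRD ler_pM2l ?expR_gt0//; apply: bernoulli_mgf_le_ge0.
  by case/andP: P01 => P0 P1; rewrite subr_ge0 P1 gerBl.
by rewrite oppr_ge0 ltW.
Qed.

Lemma chernoff_prob_rate_ge n P t s : (0 < n)%N -> 0 <= P <= 1 -> s <= 0 ->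
  1 - (expR (- (s * t)) * bernoulli_mgf P s) ^+ n <= prob_rate_ge n P t.
Proof.
move=> n0 /andP[P0 P1] s0; pose w (b : bool) := if b then P else 1 - P.
pose tilted b := expR (- (s * t)) * (w b * expR (s * b%:R)).
have w0 b : 0 <= w b by case: b; rewrite // subr_ge0.
have -> : 1 = \sum_(v : {ffun 'I_n -> bool}) \prod_(i < n) w (v i).
  by rewrite sum_prod_ffun_bool /w addrC subrK expr1n.
have -> : expR (- (s * t)) * bernoulli_mgf P s = tilted true + tilted false.
  by rewrite /tilted /= mulr1 mulr0 expR0 mulr1 -mulrDr.
rewrite -sum_prod_ffun_bool lerBlDr /prob_rate_ge.
rewrite (bigID (fun v : {ffun 'I_n -> bool} => t <= win_rate R v)) /= lerD2l.
rewrite big_mkcond /=; apply: ler_sum => v _.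
case: ifPn => [|]; last first.
  by move=> _; apply: prodr_ge0 => i _; rewrite !mulr_ge0 ?expR_ge0.
rewrite -ltNge /win_rate ltr_pdivrMl ?ltr0n// => /ltW rate_le.
rewrite /tilted !big_split /= mulrCA ler_peMr ?prodr_ge0//.
rewrite -!expR_sum -expRD -[leLHS]expR0 ler_expR sumr_const card_ord -mulr_sumr.
by rewrite mulNrn -mulrnAr addrC -mulrBr mulr_le0// subr_le0 -mulr_natl.
Qed.

Lemma hoeffding_prob_rate_ge n P t : (0 < n)%N -> 0 <= P <= 1 -> t <= P ->
  1 - expR (- (2 * n%:R * (P - t) ^+ 2)) <= prob_rate_ge n P t.
Proof.
move=> n0 P01 tP; pose s := - (4 * (P - t)).
have s0 : s <= 0 by rewrite oppr_le0 mulr_ge0// subr_ge0.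
apply: le_trans (chernoff_prob_rate_ge t n0 P01 s0); rewrite lerB//.
have -> : - (2 * n%:R * (P - t) ^+ 2)
    = n%:R * (- (s * t) + (s * P + s ^+ 2 / 8)) by rewrite /s; field.
rewrite expRM_natl expRD lerXn2r ?nnegrE ?mulr_ge0 ?expR_ge0//.
  exact/ltW/bernoulli_mgf_gt0.
by rewrite ler_pM2l ?expR_gt0// bernoulli_mgf_le.
Qed.

End Hoeffding.

(** * Averages over the depth of the test *)

Lemma expr_midf_le (F : realFieldType) m (x y : F) : 0 <= x -> 0 <= y ->
  ((x + y) / 2) ^+ m <= (x ^+ m + y ^+ m) / 2.
Proof.
move=> x0 y0; elim: m => [|m IHm]; first by rewrite !expr0 divff.
have same_sign : 0 <= (x ^+ m - y ^+ m) * (x - y).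
  wlog yx : x y x0 y0 {IHm} / y <= x => [sym|].
    by have [/sym ->//|/ltW/sym] := leP y x; rewrite -mulrNN !opprB; exact.
  by rewrite mulr_ge0 ?subr_ge0// lerXn2r.
rewrite exprSr; apply: le_trans (ler_wpM2r _ IHm) _.
  by rewrite divr_ge0 ?addr_ge0.
rewrite -subr_ge0 [leRHS](_ : _ = (x ^+ m - y ^+ m) * (x - y) / 4) ?divr_ge0//.
by rewrite !exprSr; field.
Qed.

Section DepthAverage.
Context {R : realType}.
Implicit Types (mu eps x y : R) (k : nat).

Lemma hkE k mu : (0 < k)%N -> hk k mu = k%:R^-1 * \sum_(i < k) mu ^+ i.+1.
Proof.
move=> k0; have k_neq0 : k%:R != 0 :> R by rewrite pnatr_eq0 -lt0n.
rewrite /hk; case: eqVneq => [->|mu_neq1].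
  under eq_bigr do rewrite expr1n.
  by rewrite sumr_const card_ord mulVf.
have mu_sub1_neq0 : mu - 1 != 0 by rewrite subr_eq0.
under eq_bigr do rewrite exprS.
by rewrite -mulr_sumr subrX1; field; rewrite k_neq0.
Qed.

Lemma hk_le_id k mu : (0 < k)%N -> 0 <= mu <= 1 -> hk k mu <= mu.
Proof.
move=> k0 /andP[mu0 mu1]; rewrite hkE// ler_pdivrMl ?ltr0n//.
rewrite mulr_natl -[X in _ *+ X]card_ord -sumr_const; apply: ler_sum => i _.
by rewrite exprS ler_piMr// exprn_ile1.
Qed.

Lemma hk_homo k x y : (0 < k)%N -> 0 <= x -> x <= y -> hk k x <= hk k y.
Proof.
move=> k0 x0 xy; rewrite !hkE// ler_wpM2l ?invr_ge0//; apply: ler_sum => i _.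
by rewrite lerXn2r// nnegrE// (le_trans x0).
Qed.

Lemma hkD_ge k mu eps : (0 < k)%N -> 0 <= mu <= 1 -> 0 <= eps ->
  (1 + eps) * hk k mu <= hk k (mu + eps).
Proof.
move=> k0 /andP[mu0 mu1] eps0; rewrite !hkE// mulrCA ler_wpM2l ?invr_ge0//.
rewrite mulr_sumr; apply: ler_sum => i _; rewrite !exprS mulrA.
rewrite ler_pM ?mulr_ge0 ?exprn_ge0 ?addr_ge0//.
  by rewrite mulrDl mul1r lerD2l ler_piMr.
by rewrite lerXn2r ?nnegrE ?addr_ge0// lerDl.
Qed.

(* The success probability of a test of depth [k] when every round sends [X] to
   [(2 mu - 1) X + (1 - mu) (tr X) 1], the depolarizing map of average fidelity
   [mu]. *)
Definition depolarizing_success k mu : R :=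
  k%:R^-1 * \sum_(i < k) (1 + (2 * mu - 1) ^+ i.+1) / 2.

Lemma hk_le_depolarizing_success k mu : (0 < k)%N -> 2^-1 <= mu ->
  hk k mu <= depolarizing_success k mu.
Proof.
move=> k0 mu2; rewrite hkE// ler_wpM2l ?invr_ge0//; apply: ler_sum => i _.
have -> : mu ^+ i.+1 = ((1 + (2 * mu - 1)) / 2) ^+ i.+1.
  by congr (_ ^+ _); field.
by rewrite -[X in X + _ ^+ _](expr1n _ i.+1) expr_midf_le//; lra.
Qed.

Lemma depolarizing_success_ge k mu0 eps mu : (0 < k)%N -> 0 <= mu0 <= 1 ->
  0 <= eps -> mu0 + eps <= mu -> 2^-1 <= mu ->
  (1 + eps) * hk k mu0 <= depolarizing_success k mu.
Proof.
move=> k0 mu0_itv eps0 mu_ge mu2; apply: le_trans (hkD_ge k0 mu0_itv eps0) _.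
apply: le_trans (hk_le_depolarizing_success k0 mu2).
by apply: hk_homo => //; rewrite addr_ge0//; case/andP: mu0_itv.
Qed.

Lemma depolarizing_success_le1 k mu : (0 < k)%N -> 0 <= mu <= 1 ->
  depolarizing_success k mu <= 1.
Proof.
move=> k0 /andP[mu0 mu1]; rewrite ler_pdivrMl ?ltr0n// mulr1.
rewrite -[X in _ <= X%:R]card_ord -sumr_const; apply: ler_sum => i _.
have : (2 * mu - 1) ^+ i.+1 <= 1.
  rewrite (le_trans (ler_norm _))// normrX exprn_ile1// ler_norml; lra.
lra.
Qed.

End DepthAverage.

(** * Haar averages of quadratic forms in the Bloch vector *)

Lemma sum_ord3 (G : nmodType) (F : 'I_3 -> G) :
  \sum_(i < 3) F i = F 0 + F 1 + F 2.
Proof.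
rewrite !big_ord_recl big_ord0 addr0 addrA.
by congr (_ + F _ + F _); apply: val_inj.
Qed.

Section BlochIntegral.
Import numFieldNormedType.Exports.
Context {R : realType}.
Implicit Types (f F : R -> R) (a b x th ph : R).

Lemma Rintegral_derivable_FTC2 f F a b : a < b ->
  (forall x, is_derive x (1 : R) F (f x)) ->
  (forall x, derivable f x (1 : R)) ->
  Rintegral (@lebesgue_measure R) `[a, b]%classic f = F b - F a.
Proof.
move=> ab dF df; have cF x : {for x, continuous F}.
  by apply/differentiable_continuous/derivable1_diffP; case: (dF x).
rewrite /Rintegral (@continuous_FTC2 _ f F a b ab) //.
- by apply: derivable_within_continuous => x _; exact: df.
- split=> [x _||]; first by case: (dF x).
  + by apply: cvg_at_right_filter; exact: cF.
  + by apply: cvg_at_left_filter; exact: cF.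
- by move=> x _; rewrite derive1E; apply: derive_val.
Qed.

Lemma Rintegral_azimuth (c cx cy cxx cyy cxy : R) :
  Rintegral (@lebesgue_measure R) `[0, 2 * pi]%classic
    (fun ph => c + cx * cos ph + cy * sin ph + cxx * cos ph ^+ 2
      + cyy * sin ph ^+ 2 + cxy * (cos ph * sin ph))
  = pi * (2 * c + cxx + cyy).
Proof.
pose F ph := c * ph + cx * sin ph - cy * cos ph
  + cxx * (2^-1 * (ph + sin ph * cos ph))
  + cyy * (2^-1 * (ph - sin ph * cos ph)) + cxy * (2^-1 * sin ph ^+ 2).
transitivity (F (2 * pi) - F 0); last first.
  by rewrite /F mulr_natl sin2pi cos2pi sin0 cos0; field.
apply: (@Rintegral_derivable_FTC2 _ F).
- by rewrite mulr_gt0// pi_gt0.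
- move=> ph; rewrite /F; apply: is_derive_eq; rewrite /GRing.scale /=.
  have cos2Dsin2_ph := cos2Dsin2 ph.
  rewrite -[X in cxx * (2^-1 * (X + _))]cos2Dsin2_ph.
  by rewrite -[X in cyy * (2^-1 * (X - _))]cos2Dsin2_ph; field.
- by move=> ph; apply: ex_derive.
Qed.

Lemma Rintegral_polar (c cz czz : R) :
  Rintegral (@lebesgue_measure R) `[0, pi]%classic
    (fun th => (c + cz * cos th + czz * cos th ^+ 2) * sin th)
  = 2 * (c + czz / 3).
Proof.
pose F th := - (c * cos th + cz / 2 * cos th ^+ 2 + czz / 3 * cos th ^+ 3).
transitivity (F pi - F 0); last by rewrite /F cospi cos0; field.
apply: (@Rintegral_derivable_FTC2 _ F).
- exact: pi_gt0.
- by move=> th; rewrite /F; apply: is_derive_eq; rewrite /GRing.scale /=; field.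
- by move=> th; apply: ex_derive.
Qed.

Definition bloch_vector th ph (a : 'I_3) : R :=
  match nat_of_ord a with
  | 0%N => sin th * cos ph
  | 1%N => sin th * sin ph
  | _ => cos th
  end.

Lemma haar_avg_quadratic (f : 'M[R[i]]_2 -> R) (c : R) (l : 'I_3 -> R)
    (q : 'I_3 -> 'I_3 -> R) :
  (forall th ph, let r := bloch_vector th ph in
    f (bloch_state th ph) =
      c + \sum_a l a * r a + \sum_a \sum_b q a b * (r a * r b)) ->
  haar_avg f = c + (\sum_a q a a) / 3.
Proof.
move=> fE; rewrite /haar_avg.
pose d0 := pi * (2 * c + q 0 0 + q 1 1); pose d1 := 2 * pi * l 2.
pose d2 := pi * (2 * q 2 2 - q 0 0 - q 1 1).
under [X in Rintegral _ _ X]funext => th.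
  rewrite [X in X * _](_ : _ = d0 + d1 * cos th + d2 * cos th ^+ 2).
    over.
  transitivity (pi * (2 * (c + l 2 * cos th + q 2 2 * cos th ^+ 2)
                      + q 0 0 * sin th ^+ 2 + q 1 1 * sin th ^+ 2)).
    rewrite -(Rintegral_azimuth _
      (l 0 * sin th + (q 0 2 + q 2 0) * (sin th * cos th))
      (l 1 * sin th + (q 1 2 + q 2 1) * (sin th * cos th)) _ _
      ((q 0 1 + q 1 0) * sin th ^+ 2)).
    congr Rintegral; apply/funext => ph; rewrite fE !sum_ord3 /bloch_vector /=.
    ring.
  by rewrite /d0 /d1 /d2 sin2cos2; ring.
rewrite Rintegral_polar sum_ord3 /d0 /d2; move: pi (@pi_gt0 R) => p p0.
by field; rewrite gt_eqF.
Qed.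

End BlochIntegral.

(** * Pauli matrices and Clifford gates *)

Section Qubit.
Context {R : realType}.
Local Notation C := (R[i]).
Local Notation qmx := 'M[C]_2.
Local Notation pauli := (@pauli R).
Local Notation is_unitary := (@Defs.is_unitary R).
Implicit Types (A B U V X Y : qmx) (a b : 'I_3) (z : C).

HB.instance Definition _ := GRing.RMorphism.copy (@cR R) (real_complex R).

Lemma complexP z z' :
  complex.Re z = complex.Re z' -> complex.Im z = complex.Im z' -> z = z'.
Proof. by case: z z' => x y [x' y'] /= -> ->. Qed.

Lemma conj_complexE z : Num.conj z = Complex (complex.Re z) (- complex.Im z).
Proof. by case: z. Qed.

Lemma sum_ord2 (G : nmodType) (F : 'I_2 -> G) : \sum_(i < 2) F i = F 0 + F 1.
Proof.
by rewrite !big_ord_recl big_ord0 addr0; congr (_ + F _); apply: val_inj.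
Qed.

Lemma mul2mxE A B i j : (A *m B) i j = A i 0 * B 0 j + A i 1 * B 1 j.
Proof. by rewrite mxE sum_ord2. Qed.

Lemma mxtrace2E A : \tr A = A 0 0 + A 1 1.
Proof. by rewrite /mxtrace sum_ord2. Qed.

Lemma mx2P A B : A 0 0 = B 0 0 -> A 0 1 = B 0 1 -> A 1 0 = B 1 0 ->
  A 1 1 = B 1 1 -> A = B.
Proof.
move=> eq00 eq01 eq10 eq11; apply/matrixP => i j.
have ord2E (k : 'I_2) : k = 0 \/ k = 1.
  by case: k => [[|[|//]] ?]; [left|right]; apply: val_inj.
by case: (ord2E i) (ord2E j) => -> [] ->.
Qed.

Lemma ord3_ind (P : 'I_3 -> Prop) : P 0 -> P 1 -> P 2 -> forall a, P a.
Proof.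
move=> P0 P1 P2 [[|[|[|//]]] a_lt].
- by have -> : Ordinal a_lt = 0 by apply: val_inj.
- by have -> : Ordinal a_lt = 1 by apply: val_inj.
- by have -> : Ordinal a_lt = 2 by apply: val_inj.
Qed.

Lemma ord3_succ_neq a : a != a + 1.
Proof. by elim/ord3_ind: a. Qed.

Lemma ord3_succ_const (T : Type) (g : 'I_3 -> T) :
  (forall b, g (b + 1) = g b) -> forall a b, g a = g b.
Proof.
move=> gS; suff g0 a : g a = g 0 by move=> a b; rewrite !g0.
have g1 : g 1 = g 0 by rewrite -(gS 0); congr g; apply: val_inj.
by elim/ord3_ind: a => //; rewrite -g1 -(gS 1); congr g; apply: val_inj.
Qed.

Lemma pauliXE : ((pauli 0 0 0 = 0) * (pauli 0 0 1 = 1) *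
  (pauli 0 1 0 = 1) * (pauli 0 1 1 = 0))%type.
Proof. by rewrite !mxE. Qed.

Lemma pauliYE : ((pauli 1 0 0 = 0) * (pauli 1 0 1 = - cI R) *
  (pauli 1 1 0 = cI R) * (pauli 1 1 1 = 0))%type.
Proof. by rewrite !mxE. Qed.

Lemma pauliZE : ((pauli 2 0 0 = 1) * (pauli 2 0 1 = 0) *
  (pauli 2 1 0 = 0) * (pauli 2 1 1 = -1))%type.
Proof. by rewrite !mxE. Qed.

Definition pauliE := (pauliXE, pauliYE, pauliZE).

Lemma mxtrace_pauli a : \tr (pauli a) = 0.
Proof. by elim/ord3_ind: a; rewrite mxtrace2E !pauliE ?addr0 ?addrN. Qed.

Lemma cI_sqr : cI R * cI R = -1.
Proof. by apply: complexP => /=; ring. Qed.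

Lemma pauli_conj a b :
  pauli b *m pauli a *m pauli b = (if a == b then 1 else -1) *: pauli a.
Proof.
by elim/ord3_ind: a; elim/ord3_ind: b; apply: mx2P;
  rewrite !mul2mxE [RHS]mxE !pauliE /=; ring: cI_sqr.
Qed.

Lemma pauli_sqr a : pauli a *m pauli a = 1%:M.
Proof.
by elim/ord3_ind: a; apply: mx2P; rewrite !mul2mxE [RHS]mxE !pauliE /=;
  ring: cI_sqr.
Qed.

Lemma pauli_decomposition X :
  X = (\tr X / 2) *: 1%:M + \sum_a (\tr (pauli a *m X) / 2) *: pauli a.
Proof.
rewrite sum_ord3; apply: mx2P; rewrite !mxE !mxtrace2E !mul2mxE !pauliE /=.
- by field.
- by field: cI_sqr.
- by field: cI_sqr.
- by field.
Qed.

Lemma sum_pauli_conj X : \sum_a pauli a *m X *m pauli a = (2 * \tr X)%:M - X.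
Proof.
by rewrite sum_ord3 mxtrace2E; apply: mx2P;
  rewrite [LHS]mxE [RHS]mxE [X in X + _]mxE !mul2mxE !pauliE !mxE /=;
  ring: cI_sqr.
Qed.

Lemma adjE A i j : adj A i j = Num.conj (A j i).
Proof. by rewrite !mxE. Qed.

Lemma adjM A B : adj (A *m B) = adj B *m adj A.
Proof. by rewrite /adj map_mxM trmx_mul. Qed.

Lemma adjK : involutive (@adj R).
Proof. by move=> A; apply/matrixP => i j; rewrite !adjE conjCK. Qed.

Lemma adj1 : adj (1%:M : qmx) = 1%:M.
Proof. by rewrite /adj map_mx1 trmx1. Qed.

Lemma adj_pauli a : adj (pauli a) = pauli a.
Proof.
by elim/ord3_ind: a; apply: mx2P; rewrite adjE !pauliE conj_complexE;
  apply: complexP; rewrite /= ?oppr0 ?opprK.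
Qed.

Lemma mxtrace_adj A : \tr (adj A) = Num.conj (\tr A).
Proof. by rewrite /adj mxtrace_tr -trace_map_mx. Qed.

Lemma is_unitary1 : is_unitary (1%:M : qmx).
Proof. by rewrite /is_unitary adj1 mulmx1. Qed.

Lemma is_unitaryM U V : is_unitary U -> is_unitary V -> is_unitary (U *m V).
Proof.
by move=> uU uV; rewrite /is_unitary adjM -mulmxA (mulmxA (adj U)) uU mul1mx.
Qed.

Lemma is_unitary_pauli a : is_unitary (pauli a).
Proof. by rewrite /is_unitary adj_pauli pauli_sqr. Qed.

Lemma is_unitaryC U : is_unitary U -> U *m adj U = 1%:M.
Proof. exact: mulmx1C. Qed.

Lemma is_unitary_adj U : is_unitary U -> is_unitary (adj U).
Proof. by move=> /is_unitaryC; rewrite /is_unitary adjK. Qed.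

Lemma uconj_is_linear U : linear (uconj U).
Proof.
by move=> z X Y; rewrite /uconj mulmxDr mulmxDl -scalemxAr -scalemxAl.
Qed.

HB.instance Definition _ U :=
  GRing.isLinear.Build C qmx qmx _ (uconj U) (uconj_is_linear U).

Lemma adj_uconj U A : adj (uconj U A) = uconj U (adj A).
Proof. by rewrite /uconj !adjM adjK mulmxA. Qed.

Lemma uconj1 X : uconj 1%:M X = X.
Proof. by rewrite /uconj adj1 mul1mx mulmx1. Qed.

Lemma uconjM U V X : uconj (U *m V) X = uconj U (uconj V X).
Proof. by rewrite /uconj adjM !mulmxA. Qed.

Lemma uconj_scalar U z : is_unitary U -> uconj U z%:M = z%:M.
Proof.
by move=> uU; rewrite /uconj scalar_mxC -mulmxA is_unitaryC// mulmx1.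
Qed.

Lemma uconj_mulmx U X Y : is_unitary U ->
  uconj U X *m uconj U Y = uconj U (X *m Y).
Proof.
by move=> uU; rewrite /uconj !mulmxA -(mulmxA _ (adj U) U) uU mulmx1.
Qed.

Lemma mxtrace_uconj U X : is_unitary U -> \tr (uconj U X) = \tr X.
Proof. by move=> uU; rewrite /uconj mxtrace_mulC mulmxA uU mul1mx. Qed.

Lemma uconj_pauli a b :
  uconj (pauli b) (pauli a) = (if a == b then 1 else -1) *: pauli a.
Proof. by rewrite /uconj adj_pauli pauli_conj. Qed.

Lemma is_clifford1 : is_clifford (1%:M : qmx).
Proof.
split=> [|a]; first exact: is_unitary1.
by exists a, false; rewrite -/(uconj _ _) uconj1 scale1r.
Qed.

Lemma is_cliffordM U V : is_clifford U -> is_clifford V -> is_clifford (U *m V).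
Proof.
move=> [uU cU] [uV cV]; split=> [|a]; first exact: is_unitaryM.
have [b [s VaE]] := cV a; have [c [s' UbE]] := cU b; exists c, (s (+) s').
rewrite -/(uconj _ _) uconjM [uconj V _]VaE linearZ /= [uconj U _]UbE scalerA.
by congr (_ *: _); case: s s' {VaE UbE} => [] []; rewrite ?mulrNN ?mulr1 ?mul1r.
Qed.

Lemma is_clifford_pauli b : is_clifford (pauli b).
Proof.
split=> [|a]; first exact: is_unitary_pauli.
exists a, (a != b); rewrite -/(uconj _ _) uconj_pauli.
by case: eqP.
Qed.

(* The rotation of the Bloch sphere by 120 degrees about (1,1,1). *)
Definition pauli_cycle : qmx := 2^-1 *: (1%:M - cI R *: \sum_a pauli a).

Lemma pauli_cycleE : ((pauli_cycle 0 0 = Complex 2^-1 (- 2^-1)) *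
  (pauli_cycle 0 1 = Complex (- 2^-1) (- 2^-1)) *
  (pauli_cycle 1 0 = Complex 2^-1 (- 2^-1)) *
  (pauli_cycle 1 1 = Complex 2^-1 2^-1))%type.
Proof.
by do !split; rewrite /pauli_cycle sum_ord3 !mxE -(rmorph_nat (@cR R)) -fmorphV;
  apply: complexP => /=; ring.
Qed.

Lemma is_unitary_pauli_cycle : is_unitary pauli_cycle.
Proof.
by apply: mx2P; rewrite !mul2mxE !adjE [RHS]mxE !pauli_cycleE !conj_complexE;
  apply: complexP => /=; field.
Qed.

Lemma uconj_pauli_cycle a : uconj pauli_cycle (pauli a) = pauli (a + 1).
Proof.
have succE : (2 + 1 = 0 :> 'I_3) * (1 + 1 = 2 :> 'I_3) * (0 + 1 = 1 :> 'I_3).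
  by do !split; apply: val_inj.
by elim/ord3_ind: a; rewrite succE /uconj; apply: mx2P;
  rewrite !mul2mxE !adjE !pauliE !pauli_cycleE !conj_complexE;
  apply: complexP => /=; field.
Qed.

Lemma is_clifford_pauli_cycle : is_clifford pauli_cycle.
Proof.
split=> [|a]; first exact: is_unitary_pauli_cycle.
by exists (a + 1), false; rewrite -/(uconj _ _) uconj_pauli_cycle scale1r.
Qed.

Section CliffordEnum.
Context {N : nat} {cl : 'I_N -> qmx}.
Hypothesis clE : clifford_enum cl.

Lemma clifford_enum_gt0 : (0 < N)%N.
Proof.
have [_ cl_surj _] := clE; have [i _] := cl_surj _ is_clifford1.
exact: leq_ltn_trans (ltn_ord i).
Qed.

Lemma clifford_enum_unitary c : is_unitary (cl c).
Proof. by have [cl_clifford _ _] := clE; case: (cl_clifford c). Qed.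

(* Right multiplication by a Clifford gate permutes the enumeration. *)
Lemma sum_clifford_enum_mulr (G : nmodType) (F : (qmx -> qmx) -> G) V :
  is_clifford V -> \sum_c F (uconj (cl c *m V)) = \sum_c F (uconj (cl c)).
Proof.
have [cl_clifford cl_surj cl_inj] := clE => cV.
have /choice[h hE] c : exists c', uconj (cl c *m V) = uconj (cl c').
  have [c' c'E] := cl_surj _ (is_cliffordM (cl_clifford c) cV).
  by exists c'; apply/funext.
have h_inj : injective h.
  move=> c c' hcc'; apply: cl_inj => X.
  rewrite -[X]uconj1 -(is_unitaryC (proj1 cV)) uconjM -!(uconjM _ V).
  by rewrite !hE hcc'.
by rewrite [RHS](reindex_inj h_inj); apply: eq_bigr => c _; rewrite hE.
Qed.

End CliffordEnum.
End Qubit.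

(** * Bilinear forms on qubit operators *)

Lemma biscalar_sqrZ (S : comNzRingType) (V : lmodType S) (B : {biscalar V})
    z u :
  B (z *: u) (z *: u) = z ^+ 2 * B u u.
Proof. by rewrite linearZl_LR linearZr_LR mulrA. Qed.

Lemma biscalar_parallelogram (S : comNzRingType) (V : lmodType S)
    (B : {biscalar V}) u v :
  B (u + v) (u + v) + B (u - v) (u - v) = 2 * (B u u + B v v).
Proof.
by rewrite !(linearDl B) !(linearDr B) !(linearNl B) !(linearNr B); ring.
Qed.

Section BilinearForm.
Context {R : realType}.
Local Notation C := (R[i]).
Local Notation qmx := 'M[C]_2.
Local Notation pauli := (@pauli R).
Implicit Types (B : {biscalar qmx}) (V X Y : qmx) (a b : 'I_3).

Lemma biscalar_pauliE B (x0 y0 : C) (x y : 'I_3 -> C) :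
  B (x0 *: 1%:M + \sum_a x a *: pauli a) (y0 *: 1%:M + \sum_b y b *: pauli b)
  = x0 * y0 * B 1%:M 1%:M + x0 * (\sum_b y b * B 1%:M (pauli b))
    + y0 * (\sum_a x a * B (pauli a) 1%:M)
    + \sum_a \sum_b x a * y b * B (pauli a) (pauli b).
Proof.
rewrite (linearDl B) !(linearDr B) !(linearZl_LR B) !(linearZr_LR B) /=.
rewrite !(linear_sumlz B) (linear_sumr B) !addrA mulrA.
congr (_ + _ * _ + _ * _ + _); apply: eq_bigr => a _.
- by rewrite linearZr_LR.
- by rewrite linearZl_LR.
- rewrite linear_sumr; apply: eq_bigr => b _.
  by rewrite linearZl_LR linearZr_LR mulrA.
Qed.

Definition clifford_invariant B : Prop :=
  forall V X Y, is_clifford V -> B (uconj V X) (uconj V Y) = B X Y.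

Section Invariant.
Variable B : {biscalar qmx}.
Hypothesis invB : clifford_invariant B.

Lemma clifford_invariant_eq0 V X Y (x y : C) : is_clifford V ->
  uconj V X = x *: X -> uconj V Y = y *: Y -> x * y = -1 -> B X Y = 0.
Proof.
move=> cV VX VY xy; apply/eqP; rewrite -eqNr -[X in _ == X](invB _ _ cV).
by rewrite VX VY linearZl_LR linearZr_LR mulrA xy mulN1r.
Qed.

Let uconj_pauli_id b : uconj (pauli b) 1%:M = 1 *: 1%:M.
Proof. by rewrite uconj_scalar ?scale1r//; exact: is_unitary_pauli. Qed.

Let uconj_pauli_succ a : uconj (pauli (a + 1)) (pauli a) = -1 *: pauli a.
Proof. by rewrite uconj_pauli (negPf (ord3_succ_neq a)). Qed.

Lemma clifford_invariant_1pauli a : B 1%:M (pauli a) = 0.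
Proof.
exact: clifford_invariant_eq0 (is_clifford_pauli _) (uconj_pauli_id _)
  (uconj_pauli_succ a) (mul1r _).
Qed.

Lemma clifford_invariant_pauli1 a : B (pauli a) 1%:M = 0.
Proof.
exact: clifford_invariant_eq0 (is_clifford_pauli _) (uconj_pauli_succ a)
  (uconj_pauli_id _) (mulr1 _).
Qed.

Lemma clifford_invariant_pauli_neq a b : a != b -> B (pauli a) (pauli b) = 0.
Proof.
move=> /negPf ab; apply: clifford_invariant_eq0 (is_clifford_pauli b)
  (uconj_pauli _ _) (uconj_pauli _ _) _.
by rewrite ab eqxx mulr1.
Qed.

Lemma clifford_invariant_pauli_diag a b :
  B (pauli a) (pauli a) = B (pauli b) (pauli b).
Proof.
apply: (ord3_succ_const (g := fun c => B (pauli c) (pauli c))) => c.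
by rewrite -!uconj_pauli_cycle (invB _ _ is_clifford_pauli_cycle).
Qed.

End Invariant.

Lemma sum_mxtrace_pauli X Y :
  \sum_a \tr (pauli a *m X) * \tr (pauli a *m Y)
  = 2 * \tr (X *m Y) - \tr X * \tr Y.
Proof.
by rewrite sum_ord3 !mxtrace2E !mul2mxE !pauliE; ring: (@cI_sqr R).
Qed.

Lemma clifford_invariantE B X Y : clifford_invariant B ->
  B X Y = B 1%:M 1%:M * (\tr X * \tr Y / 4)
    + (\sum_a B (pauli a) (pauli a)) / 6 * (\tr (X *m Y) - \tr X * \tr Y / 2).
Proof.
move=> invB.
have diagE a : B (pauli a) (pauli a) = (\sum_b B (pauli b) (pauli b)) / 3.
  rewrite (eq_bigr _ (fun b _ => clifford_invariant_pauli_diag invB b a)).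
  by rewrite sumr_const card_ord -mulr_natr; field.
rewrite [in LHS](pauli_decomposition X) [in LHS](pauli_decomposition Y).
rewrite biscalar_pauliE.
rewrite big1 => [|b _]; last by rewrite clifford_invariant_1pauli ?mulr0.
rewrite big1 => [|a _]; last by rewrite clifford_invariant_pauli1 ?mulr0.
rewrite !mulr0 !addr0 mulrC; congr (_ + _); first by field.
transitivity ((\sum_b B (pauli b) (pauli b)) / 12
    * \sum_a \tr (pauli a *m X) * \tr (pauli a *m Y)).
  rewrite mulr_sumr; apply: eq_bigr => a _.
  rewrite (bigD1 a)//= big1 ?addr0 ?diagE => [|b ba]; first by field.
  by rewrite clifford_invariant_pauli_neq ?mulr0// eq_sym.
by rewrite sum_mxtrace_pauli; field.
Qed.

(* The average of [B rho rho] over pure states [rho]: the Bloch vector [r] is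
   centred and [r a * r b] has average [(a == b)%:R / 3]. *)
Definition pure_avg B : C :=
  (B 1%:M 1%:M + (\sum_a B (pauli a) (pauli a)) / 3) / 4.

Lemma bloch_stateE (th ph : R) :
  bloch_state th ph = cR 2^-1 *: 1%:M
    + \sum_a cR (2^-1 * bloch_vector th ph a) *: pauli a.
Proof.
by rewrite /bloch_state sum_ord3 !scalerDr !scalerA -!(rmorphM (@cR R)) !addrA.
Qed.

Lemma Re_cRM (x : R) (z : C) : complex.Re (cR x * z) = x * complex.Re z.
Proof. by case: z => a b /=; ring. Qed.

Lemma Re_div_nat (z : C) n : complex.Re (z / n%:R) = complex.Re z / n%:R.
Proof. by rewrite -(rmorph_nat (@cR R)) -fmorphV mulrC Re_cRM mulrC. Qed.

Lemma haar_avg_biscalar B :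
  haar_avg (fun rho => complex.Re (B rho rho)) = complex.Re (pure_avg B).
Proof.
pose b X Y := complex.Re (B X Y) / 4.
rewrite (@haar_avg_quadratic _ _ (b 1%:M 1%:M)
  (fun a => b 1%:M (pauli a) + b (pauli a) 1%:M)
  (fun a a' => b (pauli a) (pauli a'))).
  rewrite /pure_avg Re_div_nat raddfD /= Re_div_nat raddf_sum /= /b -mulr_suml.
  by field.
move=> th ph; rewrite bloch_stateE biscalar_pauliE -rmorphM.
rewrite !raddfD /= !Re_cRM !raddf_sum /= -[X in X + _ = _]addrA -mulrDr.
rewrite -big_split mulr_sumr.
congr (_ + _ + _); first by rewrite /b; field.
  by apply: eq_bigr => a _; rewrite /= !Re_cRM /b; field.
apply: eq_bigr => a _; rewrite raddf_sum; apply: eq_bigr => a' _.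
by rewrite /= -rmorphM Re_cRM /b; field.
Qed.

(* The Pauli eigenstates form a spherical 2-design. *)
Lemma pauli_eig_avg B :
  6^-1 * (\sum_p B (pauli_eig R p) (pauli_eig R p)) = pure_avg B.
Proof.
have antipodal a : B (pauli_eig R (true, a)) (pauli_eig R (true, a))
    + B (pauli_eig R (false, a)) (pauli_eig R (false, a))
    = (B 1%:M 1%:M + B (pauli a) (pauli a)) / 2.
  rewrite /pauli_eig /= scale1r scaleN1r !biscalar_sqrZ -mulrDr.
  by rewrite biscalar_parallelogram fmorphV rmorph_nat; field.
transitivity (6^-1 * \sum_s \sum_a B (pauli_eig R (s, a)) (pauli_eig R (s, a))).
  by rewrite pair_big; congr (_ * _); apply: eq_bigr => -[].
rewrite big_bool /= -big_split /= (eq_bigr _ (fun a _ => antipodal a)).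
rewrite -mulr_suml big_split sumr_const card_ord /pure_avg /=.
by field.
Qed.

End BilinearForm.

(** * Average fidelity of a channel *)

Section Channel.
Context {R : realType}.
Local Notation C := (R[i]).
Local Notation qmx := 'M[C]_2.
Local Notation pauli := (@pauli R).
Local Notation is_unitary := (@Defs.is_unitary R).
Implicit Types (A B U X Y : qmx) (K : seq qmx).

Lemma kraus_is_linear K : linear (kraus K).
Proof.
move=> z X Y; rewrite /kraus scaler_sumr -big_split; apply: eq_bigr => A _ /=.
by rewrite mulmxDr mulmxDl -scalemxAr -scalemxAl.
Qed.

HB.instance Definition _ K :=
  GRing.isLinear.Build C qmx qmx _ (kraus K) (kraus_is_linear K).

Lemma mxtrace_kraus K X : is_channel K -> \tr (kraus K X) = \tr X.
Proof.
move=> chK; rewrite /kraus raddf_sum /=.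
under eq_bigr do rewrite mxtrace_mulC mulmxA.
by rewrite -raddf_sum -mulmx_suml chK mul1mx.
Qed.

Definition chan_form K X Y : C := \tr (kraus K X *m Y).

Lemma chan_form_is_bilinear K :
  bilinear_for (GRing.Scale.Law.clone _ _ *%R _)
    (GRing.Scale.Law.clone _ _ *%R _) (chan_form K).
Proof.
split=> [Y|X] z U V /=.
- by rewrite /chan_form linearP mulmxDl -scalemxAl mxtraceD mxtraceZ.
- by rewrite /chan_form mulmxDr -scalemxAr mxtraceD mxtraceZ.
Qed.

HB.instance Definition _ K :=
  bilinear_isBilinear.Build C qmx qmx C _ _ (chan_form K)
    (chan_form_is_bilinear K).

(* [(d F + 1) / (d + 1)] in dimension [d = 2], where [F] is the entanglement
   fidelity [\sum_(A <- K) `|\tr A| ^+ 2 / d ^ 2]. *)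
Definition kraus_fid K : R :=
  (2 + \sum_(A <- K) complex.Re (`|\tr A| ^+ 2)) / 6.

Lemma sum_mxtrace_pauli_conj A B :
  \sum_a \tr (A *m pauli a *m B *m pauli a) = 2 * \tr A * \tr B - \tr (A *m B).
Proof.
under eq_bigr => a _ do rewrite -!mulmxA (mulmxA (pauli a)).
rewrite -raddf_sum -mulmx_sumr sum_pauli_conj mulmxBr mul_mx_scalar.
by rewrite raddfB /= mxtraceZ mulrAC.
Qed.

Lemma sum_chan_form_pauli K : is_channel K ->
  \sum_a chan_form K (pauli a) (pauli a) = cR (12 * kraus_fid K - 6).
Proof.
move=> chK; rewrite /chan_form /kraus.
under eq_bigr => a _ do rewrite mulmx_suml raddf_sum /=.
rewrite exchange_big /=.
under eq_bigr => A _.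
  rewrite sum_mxtrace_pauli_conj mxtrace_adj -mulrA -normCK.
  rewrite [\tr (A *m _)]mxtrace_mulC.
  over.
rewrite sumrB -mulr_sumr -(raddf_sum (@mxtrace _ _)) /= chK mxtrace1.
have -> : \sum_(A <- K) `|\tr A| ^+ 2 = cR (6 * kraus_fid K - 2).
  rewrite /kraus_fid mulrC divfK ?pnatr_eq0// addrC addKr (raddf_sum (@cR R)).
  by apply: eq_bigr => A _; rewrite -[LHS]RRe_real ?rpredX ?normr_real.
rewrite -!(rmorph_nat (@cR R)) -rmorphM -rmorphB; congr cR.
by ring.
Qed.

Lemma mxtrace_normX2_le A : `|\tr A| ^+ 2 <= 2 * \tr (adj A *m A).
Proof.
rewrite -subr_ge0 !mxtrace2E !mul2mxE !adjE normCK rmorphD.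
rewrite [leRHS](_ : _ = `|A 0 0 - A 1 1| ^+ 2
    + 2 * `|A 0 1| ^+ 2 + 2 * `|A 1 0| ^+ 2).
  by rewrite !addr_ge0 ?mulr_ge0 ?exprn_ge0.
rewrite !normCK rmorphB; ring.
Qed.

Lemma kraus_fid_le1 K : is_channel K -> kraus_fid K <= 1.
Proof.
move=> chK; rewrite /kraus_fid ler_pdivrMr ?ltr0n// mul1r.
suff : \sum_(A <- K) complex.Re (`|\tr A| ^+ 2) <= 4 by lra.
have -> : 4 = complex.Re (2 * \sum_(A <- K) \tr (adj A *m A)).
  rewrite -(raddf_sum (@mxtrace _ _)) /= chK mxtrace1 -natrM.
  by rewrite -(rmorph_nat (@cR R)).
rewrite mulr_sumr raddf_sum; apply: ler_sum => A _.
by have := mxtrace_normX2_le A; rewrite lecE => /andP[].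
Qed.

Lemma chan_form11 K : is_channel K -> chan_form K 1%:M 1%:M = 2.
Proof. by move=> chK; rewrite /chan_form mulmx1 mxtrace_kraus// mxtrace1. Qed.

Lemma pure_avg_chan_form K : is_channel K ->
  pure_avg (chan_form K) = cR (kraus_fid K).
Proof.
move=> chK; rewrite /pure_avg /= sum_chan_form_pauli// chan_form11//.
rewrite -!(rmorph_nat (@cR R)) -!fmorphV -!(rmorphM, rmorphD); congr cR.
by field.
Qed.

Lemma avg_fid_kraus K U : is_channel K -> is_unitary U ->
  avg_fid (fun rho => uconj U (kraus K rho)) (uconj U) = kraus_fid K.
Proof.
move=> chK uU; rewrite -[RHS](congr1 (@complex.Re R) (pure_avg_chan_form chK)).
rewrite -haar_avg_biscalar /avg_fid; congr haar_avg; apply/funext => rho.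
by rewrite uconj_mulmx// mxtrace_uconj.
Qed.

Lemma is_channel_uconj K U : is_unitary U -> is_channel K ->
  is_channel (map (uconj U) K).
Proof.
move=> uU; rewrite /is_channel big_map => chK.
under eq_bigr do rewrite adj_uconj uconj_mulmx//.
by rewrite -raddf_sum /= chK uconj_scalar.
Qed.

Lemma kraus_fid_uconj K U : is_unitary U ->
  kraus_fid (map (uconj U) K) = kraus_fid K.
Proof.
move=> uU; rewrite /kraus_fid big_map.
by under eq_bigr do rewrite mxtrace_uconj//.
Qed.

Lemma chan_form_uconj K U X Y : is_unitary U ->
  chan_form K (uconj U X) (uconj U Y) = chan_form (map (uconj (adj U)) K) X Y.
Proof.
move=> uU; rewrite /chan_form -[RHS](mxtrace_uconj _ uU) -uconj_mulmx//.
congr (\tr (_ *m _)); rewrite /kraus big_map raddf_sum.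
apply: eq_bigr => A _ /=.
have uconjK B : uconj U (uconj (adj U) B) = B.
  by rewrite -uconjM is_unitaryC// uconj1.
rewrite adj_uconj -[X in X *m _ *m _ = _]uconjK -[X in _ *m X = _]uconjK.
by rewrite !uconj_mulmx.
Qed.

End Channel.

(** * Twirling over the Clifford group *)

Section Twirl.
Context {R : realType}.
Local Notation C := (R[i]).
Local Notation qmx := 'M[C]_2.
Local Notation pauli := (@pauli R).
Implicit Types (B : {biscalar qmx}) (X Y : qmx) (K : seq qmx).

Definition clifford_sum N (cl : 'I_N -> qmx) B X Y : C :=
  \sum_c B (uconj (cl c) X) (uconj (cl c) Y).

Lemma clifford_sum_is_bilinear N (cl : 'I_N -> qmx) B :
  bilinear_for (GRing.Scale.Law.clone _ _ *%R _)
    (GRing.Scale.Law.clone _ _ *%R _) (clifford_sum cl B).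
Proof.
split=> [Y|X] z U V; rewrite /clifford_sum /= mulr_sumr -big_split;
  apply: eq_bigr => c _ /=.
- by rewrite [uconj _ _]linearP linearPl.
- by rewrite [uconj _ (_ + _)]linearP linearPr.
Qed.

HB.instance Definition _ N (cl : 'I_N -> qmx) B :=
  bilinear_isBilinear.Build C qmx qmx C _ _ (clifford_sum cl B)
    (clifford_sum_is_bilinear cl B).

Definition depolarizing_form (f : R) X Y : C :=
  \tr X * \tr Y / 2 + cR f * (\tr (X *m Y) - \tr X * \tr Y / 2).

Lemma depolarizing_form_kraus f K X Y : is_channel K ->
  depolarizing_form f (kraus K X) Y
  = \tr X * \tr Y / 2 + cR f * (chan_form K X Y - \tr X * \tr Y / 2).
Proof. by move=> chK; rewrite /depolarizing_form mxtrace_kraus. Qed.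

Section CliffordEnum.
Context {N : nat} {cl : 'I_N -> qmx}.
Hypothesis clE : clifford_enum cl.

Lemma clifford_sum_invariant B : clifford_invariant (clifford_sum cl B).
Proof.
move=> V X Y cV; rewrite /= /clifford_sum.
under eq_bigr do rewrite -!uconjM.
exact: (sum_clifford_enum_mulr clE (fun g => B (g X) (g Y)) cV).
Qed.

Lemma clifford_sum_chan_form K X Y : is_channel K ->
  clifford_sum cl (chan_form K) X Y
  = N%:R * depolarizing_form (2 * kraus_fid K - 1) X Y.
Proof.
move=> chK; rewrite (clifford_invariantE _ _ (clifford_sum_invariant _)) /=.
have -> : clifford_sum cl (chan_form K) 1%:M 1%:M = 2 * N%:R.
  rewrite /clifford_sum /=; under eq_bigr => c _.
    rewrite uconj_scalar ?chan_form11//; last exact: clifford_enum_unitary.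
    over.
  by rewrite sumr_const card_ord mulr_natr.
have -> : \sum_a clifford_sum cl (chan_form K) (pauli a) (pauli a)
    = N%:R * cR (12 * kraus_fid K - 6).
  rewrite exchange_big /=; under eq_bigr => c _.
    have cl_unitary := clifford_enum_unitary clE c.
    have adj_unitary := is_unitary_adj cl_unitary.
    under eq_bigr do rewrite chan_form_uconj//.
    rewrite sum_chan_form_pauli; last exact: is_channel_uconj.
    rewrite kraus_fid_uconj//; over.
  by rewrite sumr_const card_ord [RHS]mulr_natl.
rewrite /depolarizing_form !rmorphB !rmorphM rmorph1 !rmorph_nat.
by field.
Qed.

Lemma sum_depolarizing_form_kraus f K X Y : is_channel K ->
  \sum_c depolarizing_form f (kraus K (uconj (cl c) X)) (uconj (cl c) Y)
  = N%:R * depolarizing_form (f * (2 * kraus_fid K - 1)) X Y.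
Proof.
move=> chK; under eq_bigr => c _.
  have cl_unitary := clifford_enum_unitary clE c.
  rewrite depolarizing_form_kraus// !mxtrace_uconj//.
  over.
rewrite big_split /= sumr_const -mulr_sumr sumrB sumr_const card_ord.
rewrite -/(clifford_sum cl (chan_form K) X Y) clifford_sum_chan_form//.
by rewrite -[_ *+ N]mulr_natl /depolarizing_form rmorphM /=; ring.
Qed.

End CliffordEnum.

Lemma mxtrace_pauli_eig p : \tr (pauli_eig R p) = 1.
Proof.
rewrite mxtraceZ mxtraceD mxtraceZ mxtrace1 mxtrace_pauli mulr0 addr0.
by rewrite fmorphV rmorph_nat mulVf ?pnatr_eq0.
Qed.

Lemma pauli_eig_avg_depolarizing_form f K : is_channel K ->
  6^-1 * (\sum_p depolarizing_form f (kraus K (pauli_eig R p)) (pauli_eig R p))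
  = cR ((1 + f * (2 * kraus_fid K - 1)) / 2).
Proof.
move=> chK; under eq_bigr => p _.
  rewrite depolarizing_form_kraus// mxtrace_pauli_eig mulr1; over.
rewrite big_split /= sumr_const -mulr_sumr sumrB sumr_const.
rewrite card_prod card_bool card_ord.
have -> : \sum_p chan_form K (pauli_eig R p) (pauli_eig R p)
    = 6 * cR (kraus_fid K).
  by rewrite -pure_avg_chan_form// -pauli_eig_avg mulVKf ?pnatr_eq0.
move: (kraus_fid K) => fid.
rewrite fmorph_div rmorphD rmorphM rmorphB rmorphM rmorph1 !rmorph_nat /=.
by field.
Qed.

End Twirl.

(** * The ping-pong protocol *)

Lemma sum_tuple_cons (G : nmodType) (T : finType) m (F : m.+1.-tuple T -> G) :
  \sum_(t : m.+1.-tuple T) F t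
  = \sum_(x : T) \sum_(t : m.-tuple T) F [tuple of x :: t].
Proof.
rewrite pair_big /=.
rewrite (reindex (fun p : T * m.-tuple T => [tuple of p.1 :: p.2])) //=.
exists (fun t : m.+1.-tuple T => (thead t, [tuple of behead t])).
  by move=> [x t] _ /=; congr pair; apply: val_inj.
by move=> t _; rewrite [RHS]tuple_eta.
Qed.

Section PingPong.
Context {R : realType} {N k : nat} {cl : 'I_N -> 'M[R[i]]_2}.
Context {M : nat -> seq 'M[R[i]]_2} {mu : R}.
Local Notation C := (R[i]).
Implicit Types (X Y : 'M[C]_2).
Hypothesis clE : clifford_enum cl.
Hypothesis chanM : forall j, (j < k)%N -> is_channel (M j).
Hypothesis fidM : forall j, (j < k)%N -> kraus_fid (M j) = mu.

Lemma sum_run m j X Y : (j + m < k)%N ->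
  \sum_(cs : m.+1.-tuple 'I_N) \tr (noisy_run M cl cs j X *m ideal_run cl cs Y)
  = N%:R ^+ m.+1 * depolarizing_form ((2 * mu - 1) ^+ m) (kraus (M j) X) Y.
Proof.
elim: m j X Y => [|m IHm] j X Y jk; rewrite sum_tuple_cons /=.
  under eq_bigr => c _.
    rewrite (big_pred1 [tuple]) /=; last first.
      by move=> cs; rewrite (tuple0 cs); apply/esym/eqP.
    rewrite uconj_mulmx ?mxtrace_uconj; [|exact: clifford_enum_unitary..].
    over.
  rewrite sumr_const card_ord -[LHS]mulr_natl expr1 expr0.
  by rewrite /depolarizing_form rmorph1 mul1r addrC subrK.
have j1k : (j.+1 + m < k)%N by rewrite addSnnS.
have jS : (j.+1 < k)%N by rewrite (leq_ltn_trans _ j1k)// leq_addr.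
under eq_bigr => c _ do rewrite IHm//.
rewrite -mulr_sumr (sum_depolarizing_form_kraus clE)//; last exact: chanM.
by rewrite fidM// mulrA -exprSr -exprSr.
Qed.

Lemma success_probE : success_prob cl M k = depolarizing_success k mu.
Proof.
rewrite /success_prob; congr (_ * _); apply: eq_bigr => i _.
have k0 : (0 < k)%N by apply: leq_ltn_trans (ltn_ord i).
have N_neq0 : N%:R ^+ i.+1 != 0 :> R.
  by rewrite expf_neq0// pnatr_eq0 -lt0n (clifford_enum_gt0 clE).
rewrite -mulr_sumr exchange_big /=.
under eq_bigr => p _.
  rewrite -(raddf_sum (@complex.Re R)) /= sum_run ?add0n//.
  rewrite -(rmorph_nat (@cR R)) -rmorphXn Re_cRM.
  over.
rewrite /= -mulr_sumr mulrCA mulKf// -raddf_sum mulrC -Re_div_nat mulrC.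
rewrite pauli_eig_avg_depolarizing_form; last exact: chanM.
by rewrite fidM// -exprSr.
Qed.

End PingPong.

Theorem theorem3 (R : realType) (k n N : nat)
    (cl : 'I_N -> 'M[R[i]]_2) (M : nat -> seq 'M[R[i]]_2)
    (mu t eps mu0 : R) :
  (0 < k)%N -> (0 < n)%N ->
  clifford_enum cl ->
  (forall j, (j < k)%N -> is_channel (M j)) ->
  (forall j, (j < k)%N -> forall c : 'I_N,
      avg_fid (fun rho => uconj (cl c) (kraus (M j) rho)) (uconj (cl c)) = mu) ->
  5 / 6 < t -> t <= 1 -> 0 < eps ->
  0 <= mu0 -> mu0 <= 1 -> hk k mu0 = t ->
  mu0 + eps <= mu ->
  1 - expR (- (n%:R * eps ^+ 2)) <= prob_rate_ge n (success_prob cl M k) t.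
Proof.
move=> k0 n0 clE chanM avg_fidM t_gt _ eps0 mu0_ge0 mu0_le1 hk_mu0 mu_ge.
have fidM j (jk : (j < k)%N) : kraus_fid (M j) = mu.
  rewrite -(avg_fidM j jk (Ordinal (clifford_enum_gt0 clE))) avg_fid_kraus//.
    exact: chanM.
  exact: clifford_enum_unitary.
have mu_le1 : mu <= 1 by rewrite -(fidM 0%N k0) kraus_fid_le1//; exact: chanM.
have mu0_gt : 5 / 6 < mu0.
  by rewrite (lt_le_trans t_gt)// -hk_mu0 hk_le_id ?mu0_ge0.
rewrite (success_probE clE chanM fidM); set P := depolarizing_success k mu.
have P_le1 : P <= 1 by apply: depolarizing_success_le1 => //; lra.
have P_ge : (1 + eps) * t <= P.
  by rewrite -hk_mu0; apply: depolarizing_success_ge => //; lra.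
have gap : 5 / 6 * eps <= P - t by nra.
have P01 : 0 <= P <= 1 by lra.
have tP : t <= P by lra.
apply: le_trans (hoeffding_prob_rate_ge n0 P01 tP).
have gap_sqr : eps ^+ 2 <= 2 * (P - t) ^+ 2 by nra.
by rewrite lerB// ler_expR lerN2 -mulrA (mulrCA 2) ler_wpM2l.
Qed.
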